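(* Let $R$ be a ring. (i) Let $\mathcal Q$ and $\mathcal Q'$ be classes of left $R$-modules containing $R$. Then $\mathcal D_{\mathcal Q} = \mathcal D_{\mathcal Q'}$ if and only if $\mathcal D_{\mathcal Q}$ and $\mathcal D_{\mathcal Q'}$ contain the same countably presented modules. (ii) Let $\mathcal Q$ be an arbitrary class of left $R$-modules. Then $\mathcal D_{\mathcal Q} = \mathcal F$ if and only if each countably presented flat module is $\mathcal Q$-Mittag-Leffler. (iii) Let $\mathcal Q$ be a class of left $R$-modules containing $R$. Then $\mathcal D_{\mathcal Q} = \mathcal{FM}$ if and only if each countably presented flat $\mathcal Q$-Mittag-Leffler module is projective.
   Context: Rings are associative with unit; ''module'' means right $R$-module unless specified otherwise. For a class $\mathcal Q$ of left $R$-modules, a module $M$ is $\mathcal Q$-Mittag-Leffler if the canonical map $M \otimes_R \prod_{i \in I} Q_i \to \prod_{i \in I} M \otimes_R Q_i$, $m \otimes (q_i)_{i\in I} \mapsto (m \otimes q_i)_{i \in I}$, is injective for every family $(Q_i \mid i \in I)$ of elements of $\mathcal Q$. A module is Mittag-Leffler if it is $\mathcal Q$-Mittag-Leffler for $\mathcal Q$ the class of all left $R$-modules. $\mathcal F$ denotes the class of all flat modules, $\mathcal{FM}$ the class of all flat Mittag-Leffler modules, and $\mathcal D_{\mathcal Q}$ the class of all flat $\mathcal Q$-Mittag-Leffler modules. ''Containing $R$'' refers to the regular left $R$-module. *)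

(* Defs.v *)
From HB Require Import structures.
From mathcomp Require Import all_boot all_order all_algebra.
From mathcomp Require Import boolp classical_sets functions cardinality fsbigop.

Set Implicit Arguments.
Unset Strict Implicit.
Unset Printing Implicit Defensive.

Import GRing.Theory.
Local Open Scope quotient_scope.
Local Open Scope classical_set_scope.
Local Open Scope ring_scope.

(* Left R-modules are [lmodType R].  Right R-modules are left modules over the
   converse ring: for M : rmodType R, the element m r is (r : R^c) *: m. *)
Notation rmodType R := (lmodType R^c).

Section FreeModule.
Variables (S : pzRingType) (X : choiceType).

Definition finsupp_pred : {pred X -> S^o} :=
  fun u => `[< finite_set [set x | u x <> 0] >].

Lemma finsupp_submod_closed : submod_closed finsupp_pred.
Proof.
split=> [|a u v]; rewrite !unfold_in /finsupp_pred.
  apply/asboolP; apply: (@sub_finite_set _ _ set0) => //; exact: finite_set0.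
move=> /asboolP fu /asboolP fv; apply/asboolP.
apply: (@sub_finite_set _ _ ([set x | u x <> 0] `|` [set x | v x <> 0])).
  move=> x /=; apply: contra_notP => /not_orP[/contrapT u0 /contrapT v0].
  by rewrite !fctE u0 v0 scaler0 addr0.
by rewrite finite_setU.
Qed.

HB.instance Definition _ :=
  GRing.isSubmodClosed.Build S (X -> S^o) finsupp_pred finsupp_submod_closed.

(* The free left S-module S^(X). *)
Record free_mod := FreeMod {
  free_fun :> X -> S^o;
  free_funP : free_fun \in finsupp_pred }.

HB.instance Definition _ := [isSub for free_fun].
HB.instance Definition _ := [Choice of free_mod by <:].
HB.instance Definition _ := [SubChoice_isSubLmodule of free_mod by <:].

Lemma free_gen_subproof (x : X) :
  (fun y => (y == x)%:R : S^o) \in finsupp_pred.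
Proof.
rewrite unfold_in /finsupp_pred; apply/asboolP.
apply: (@sub_finite_set _ _ [set x]); last exact: finite_set1.
by move=> y /=; case: eqP.
Qed.

Definition free_gen (x : X) : free_mod := FreeMod (free_gen_subproof x).

Definition free_lift (V : lmodType S) (f : X -> V) (u : free_mod) : V :=
  \sum_(x \in [set: X]) (u x : S) *: f x.

Lemma free_liftE (V : lmodType S) (f : X -> V) (u : free_mod) (A : set X) :
  finite_set A -> (forall x, u x <> 0 -> A x) ->
  free_lift f u = \sum_(x \in A) (u x : S) *: f x.
Proof.
move=> finA uA; apply/esym/fsbig_widen => // x [_ /= nAx].
by have [->|/eqP/uA//] := eqVneq (u x) 0; rewrite scale0r.
Qed.

Lemma free_mod_finite (u : free_mod) : finite_set [set x | u x <> 0].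
Proof. by case: u => u /= uP; apply/asboolP. Qed.

Lemma free_lift_is_linear (V : lmodType S) (f : X -> V) : linear (free_lift f).
Proof.
move=> a u v.
pose A := [set x | u x <> 0] `|` [set x | v x <> 0].
have finA : finite_set A by rewrite finite_setU; split; exact: free_mod_finite.
have uA x : u x <> 0 -> A x by left.
have vA x : v x <> 0 -> A x by right.
have uvE x : (a *: u + v) x = a * u x + v x by [].
rewrite (free_liftE f finA uA) (free_liftE f finA vA) (@free_liftE _ _ _ A)//.
  rewrite !fsbig_finite//= scaler_sumr -big_split/=.
  by apply: eq_bigr => x _; rewrite scalerA -scalerDl.
move=> x; apply: contra_notP => /not_orP[/contrapT u0 /contrapT v0].
by rewrite uvE u0 v0 mulr0 addr0.
Qed.

HB.instance Definition _ (V : lmodType S) (f : X -> V) :=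
  GRing.isLinear.Build S free_mod V *:%R (free_lift f) (free_lift_is_linear f).

Lemma free_lift_gen (V : lmodType S) (f : X -> V) (x : X) :
  free_lift f (free_gen x) = f x.
Proof.
rewrite (@free_liftE _ _ _ [set x]) ?fsbig_set1 /= ?eqxx ?scale1r//.
by move=> y /=; case: eqP.
Qed.

End FreeModule.

Section ProductZmod.
Variables (I : Type) (V : I -> zmodType).

Definition zprod : Type := forall i, V i.

HB.instance Definition _ := gen_eqMixin zprod.
HB.instance Definition _ := gen_choiceMixin zprod.

Local Notation P := zprod.

Definition zprod_zero : P := fun i => 0.
Definition zprod_opp (f : P) : P := fun i => - f i.
Definition zprod_add (f g : P) : P := fun i => f i + g i.

Lemma zprod_addA : associative zprod_add.
Proof. by move=> f g h; apply: functional_extensionality_dep => i; exact: addrA. Qed.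
Lemma zprod_addC : commutative zprod_add.
Proof. by move=> f g; apply: functional_extensionality_dep => i; exact: addrC. Qed.
Lemma zprod_add0 : left_id zprod_zero zprod_add.
Proof. by move=> f; apply: functional_extensionality_dep => i; exact: add0r. Qed.
Lemma zprod_addN : left_inverse zprod_zero zprod_opp zprod_add.
Proof. by move=> f; apply: functional_extensionality_dep => i; exact: addNr. Qed.

HB.instance Definition _ :=
  GRing.isZmodule.Build P zprod_addA zprod_addC zprod_add0 zprod_addN.

End ProductZmod.

Section ProductLmod.
Variables (R : pzRingType) (I : Type) (V : I -> lmodType R).

Definition lprod : Type := zprod V.

HB.instance Definition _ := GRing.Zmodule.on lprod.

Local Notation P := lprod.

Definition lprod_scale (a : R) (f : P) : P := fun i => a *: f i.

Lemma lprod_scaleA a b f : lprod_scale a (lprod_scale b f) = lprod_scale (a * b) f.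
Proof. by apply: functional_extensionality_dep => i; exact: scalerA. Qed.
Lemma lprod_scale1 : left_id 1 lprod_scale.
Proof. by move=> f; apply: functional_extensionality_dep => i; exact: scale1r. Qed.
Lemma lprod_scaleDr : right_distributive lprod_scale +%R.
Proof. by move=> a f g; apply: functional_extensionality_dep => i; exact: scalerDr. Qed.
Lemma lprod_scaleDl f : {morph lprod_scale^~ f : a b / a + b}.
Proof. by move=> a b; apply: functional_extensionality_dep => i; exact: scalerDl. Qed.

HB.instance Definition _ := GRing.Zmodule_isLmodule.Build R P
  lprod_scaleA lprod_scale1 lprod_scaleDr lprod_scaleDl.

End ProductLmod.

Section Tensor.
Variables (R : pzRingType) (M : rmodType R) (Q : lmodType R).

Local Notation Z := (free_mod int (M * Q)%type).

Definition tensor_gen (m : M) (q : Q) : Z := free_gen int (m, q).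

Inductive tensor_rel : Z -> Prop :=
| tensor_relDl m m' q :
    tensor_rel (tensor_gen (m + m') q - (tensor_gen m q + tensor_gen m' q))
| tensor_relDr m q q' :
    tensor_rel (tensor_gen m (q + q') - (tensor_gen m q + tensor_gen m q'))
| tensor_relZ m (r : R) q :
    tensor_rel (tensor_gen ((r : R^c) *: m) q - tensor_gen m (r *: q))
| tensor_rel0 : tensor_rel 0
| tensor_relB x y : tensor_rel x -> tensor_rel y -> tensor_rel (x - y).

Definition tensor_relb : {pred Z} := fun x => `[< tensor_rel x >].

Lemma tensor_relb_zmod_closed : zmod_closed tensor_relb.
Proof.
split=> [|x y]; rewrite !unfold_in /tensor_relb; first exact/asboolP/tensor_rel0.
by move=> /asboolP hx /asboolP hy; apply/asboolP/tensor_relB.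
Qed.

HB.instance Definition _ :=
  GRing.isZmodClosed.Build Z tensor_relb tensor_relb_zmod_closed.

(* M (x)_R Q: the free abelian group on M * Q modulo the subgroup [tensor_rel]. *)
Definition tensor : Type := Quotient.quot tensor_relb.
HB.instance Definition _ := GRing.Zmodule.on tensor.

Definition tensor_class (x : Z) : tensor := \pi_(Quotient.quot tensor_relb) x.
Definition pure (m : M) (q : Q) : tensor := tensor_class (tensor_gen m q).

Definition balanced (V : zmodType) (f : M -> Q -> V) : Prop :=
  [/\ forall m m' q, f (m + m') q = f m q + f m' q,
      forall m q q', f m (q + q') = f m q + f m q'
    & forall m (r : R) q, f ((r : R^c) *: m) q = f m (r *: q)].

(* The additive map induced by f; meaningful when f is balanced. *)
Definition tensor_lift (V : zmodType) (f : M -> Q -> V) (t : tensor) : V :=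
  free_lift (fun p : M * Q => f p.1 p.2 : zmodule V) (repr t).

Lemma tensor_classP (x y : Z) :
  tensor_class x = tensor_class y <-> tensor_rel (x - y).
Proof.
split=> [/eqP|xy]; first by rewrite -Quotient.idealrBE => /asboolP.
by apply/eqP; rewrite -Quotient.idealrBE; apply/asboolP.
Qed.

Lemma tensor_class_is_zmod_morphism : zmod_morphism tensor_class.
Proof. exact: raddfB. Qed.

Lemma tensor_classK (t : tensor) : tensor_class (repr t) = t.
Proof. exact: reprK. Qed.

HB.instance Definition _ :=
  GRing.isZmodMorphism.Build Z tensor tensor_class tensor_class_is_zmod_morphism.

Lemma pure_balanced : balanced pure.
Proof.
split=> [m m' q|m q q'|m r q]; rewrite /pure -?raddfD; apply/tensor_classP.
- exact: tensor_relDl.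
- exact: tensor_relDr.
- exact: tensor_relZ.
Qed.

Section Lift.
Variables (V : zmodType) (f : M -> Q -> V) (bf : balanced f).

Lemma tensor_lift_class (x : Z) :
  tensor_lift f (tensor_class x) =
  free_lift (fun p : M * Q => f p.1 p.2 : zmodule V) x.
Proof.
rewrite /tensor_lift; set g := fun p : M * Q => _.
suff F0 y : tensor_rel y -> @free_lift int _ (zmodule V) g y = 0.
  apply: (@subr0_eq (zmodule V)); rewrite -raddfB; apply: F0.
  by apply/tensor_classP; rewrite tensor_classK.
have genE m q : @free_lift int _ (zmodule V) g (tensor_gen m q) = f m q.
  exact: free_lift_gen.
case: bf => bDl bDr bZ.
elim=> [m m' q|m q q'|m r q||a b _ Fa _ Fb].
- by rewrite raddfB raddfD /= !genE bDl subrr.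
- by rewrite raddfB raddfD /= !genE bDr subrr.
- by rewrite raddfB /= !genE bZ subrr.
- by rewrite raddf0.
- by rewrite raddfB /= Fa Fb subrr.
Qed.

Lemma tensor_lift_is_zmod_morphism : zmod_morphism (tensor_lift f).
Proof.
move=> t u; rewrite -[t]tensor_classK -[u]tensor_classK.
by rewrite -tensor_class_is_zmod_morphism !tensor_lift_class raddfB.
Qed.

Lemma tensor_lift_pure m q : tensor_lift f (pure m q) = f m q.
Proof. by rewrite tensor_lift_class free_lift_gen. Qed.

End Lift.

End Tensor.

(* The map id (x) f : M (x) A -> M (x) B *)
Definition tensor_map (R : pzRingType) (M : rmodType R) (A B : lmodType R)
    (f : {linear A -> B}) : tensor M A -> tensor M B :=
  tensor_lift (fun m a => pure m (f a)).

(* The canonical map M (x) prod_i Q_i -> prod_i (M (x) Q_i) *)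
Definition tensor_prod (R : pzRingType) (M : rmodType R) (I : Type)
    (Q : I -> lmodType R) :
    tensor M (lprod Q : lmodType R) -> zprod (fun i => tensor M (Q i)) :=
  tensor_lift (fun (m : M) (q : lprod Q) =>
    (fun i => pure m (q i)) : zprod (fun i => tensor M (Q i))).

Section CanonicalMaps.
Variables (R : pzRingType) (M : rmodType R).

Lemma tensor_map_balanced (A B : lmodType R) (f : {linear A -> B}) :
  balanced (fun (m : M) a => pure m (f a)).
Proof.
by have [bl br bz] := @pure_balanced R M B;
  split=> *; rewrite ?raddfD ?linearZ ?bl ?br ?bz.
Qed.

Lemma tensor_map_is_zmod_morphism (A B : lmodType R) (f : {linear A -> B}) :
  zmod_morphism (tensor_map (M := M) f).
Proof. exact/tensor_lift_is_zmod_morphism/tensor_map_balanced. Qed.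

Lemma tensor_map_pure (A B : lmodType R) (f : {linear A -> B}) (m : M) a :
  tensor_map f (pure m a) = pure m (f a).
Proof. exact/tensor_lift_pure/tensor_map_balanced. Qed.

Lemma tensor_prod_balanced (I : Type) (Q : I -> lmodType R) :
  balanced (fun (m : M) (q : lprod Q) =>
    (fun i => pure m (q i)) : zprod (fun i => tensor M (Q i))).
Proof.
split=> [m m' q|m q q'|m r q]; apply: functional_extensionality_dep => i;
  have [bl br bz] := @pure_balanced R M (Q i).
- exact: bl.
- exact: br.
- exact: bz.
Qed.

Lemma tensor_prod_is_zmod_morphism (I : Type) (Q : I -> lmodType R) :
  zmod_morphism (tensor_prod (M := M) (Q := Q)).
Proof. exact/tensor_lift_is_zmod_morphism/tensor_prod_balanced. Qed.

Lemma tensor_prod_pure (I : Type) (Q : I -> lmodType R) (m : M)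
    (q : lprod Q) :
  tensor_prod (pure m q) = fun i => pure m (q i).
Proof. exact/tensor_lift_pure/tensor_prod_balanced. Qed.

End CanonicalMaps.

Section ModuleClasses.
Variable R : pzRingType.

Definition flat (M : rmodType R) : Prop :=
  forall (A B : lmodType R) (f : {linear A -> B}),
    injective f -> injective (tensor_map (M := M) f).

Definition projective (M : rmodType R) : Prop :=
  forall (A B : rmodType R) (g : {linear A -> B}) (f : {linear M -> B}),
    (forall b, exists a, g a = b) ->
    exists h : {linear M -> A}, forall m, g (h m) = f m.

(* Exactness of R^(K) -> R^(L) -> M -> 0 with K and L countable. *)
Definition countably_presented (M : rmodType R) : Prop :=
  exists (K L : countType)
    (f : {linear free_mod R^c K -> free_mod R^c L})
    (g : {linear free_mod R^c L -> M}),
    (forall x, g x = 0 <-> exists y, f y = x) /\ (forall m, exists x, g x = m).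

Definition mittag_leffler_for (Q : lmodType R -> Prop) (M : rmodType R) : Prop :=
  forall (I : Type) (N : I -> lmodType R),
    (forall i, Q (N i)) -> injective (tensor_prod (M := M) (Q := N)).

Definition mittag_leffler : rmodType R -> Prop :=
  mittag_leffler_for (fun _ => True).

Definition flat_ML_for (Q : lmodType R -> Prop) (M : rmodType R) : Prop :=
  flat M /\ mittag_leffler_for Q M.

Definition flat_ML (M : rmodType R) : Prop := flat M /\ mittag_leffler M.

End ModuleClasses.

(* A class of modules is a predicate; classes are equal when they have the same
   members. *)
Definition same_class (T : Type) (C D : T -> Prop) : Prop :=
  forall M, C M <-> D M.

(* Main.v *)
Require Import Defs.
From HB Require Import structures.
From mathcomp Require Import all_boot all_algebra.
From mathcomp Require Import boolp classical_sets functions cardinality fsbigop.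

Set Implicit Arguments.
Unset Strict Implicit.
Unset Printing Implicit Defensive.

Import GRing.Theory.
Local Open Scope quotient_scope.
Local Open Scope ring_scope.

(** Write a tuple [m] of a right module as a row, a tuple [q] of a left module
    as a column, and [m (x) q] for the sum of the [m_i (x) q_i].  A factorization
    [m = m' B] through a matrix [B] gives [m (x) q = m' (x) B q], so [B q = 0]
    forces [m (x) q = 0].  Over a flat module the converse holds for each [q]
    separately: if [m (x) q = 0] then some factorization of [m] kills [q]
    ([flat_tens_eq0]).  A flat module is Mittag-Leffler for a class [Q] exactly
    when, for each [m], one factorization kills every such [q] taken from [Q] at
    once; this is [detects], and the equivalence is [factor_mittag_leffler] and
    [mittag_leffler_factor].

    All three parts rest on [flat_ML_transfer]: if every countably presented
    flat [Q]-Mittag-Leffler module is [Q']-Mittag-Leffler, then so is every flat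
    [Q]-Mittag-Leffler module [M].  Suppose that no factorization of a tuple
    [m_0] of [M] detects [Q'].  Build inductively tuples [m_k] and matrices
    [B_k] with [m_k = m_{k+1} B_k] such that [B_k] detects [Q] on [m_k], and,
    with [P_k = B_{k-1} ... B_0], such that some [q_k] from [Q'] has
    [m_0 (x) q_k = 0], [P_k q_k <> 0] and [P_{k+1} q_k = 0].  The colimit [N] of
    the finite free modules joined by the [B_k] is countably presented and flat,
    and it is [Q]-Mittag-Leffler because the [B_k] detect [Q].  By assumption it
    is [Q']-Mittag-Leffler; but a factorization that detects [Q'] on the image
    of [m_0] in [N] factors some [P_j], so that [P_j q_j = 0], a contradiction.

    Part (i) is this statement in both directions, and part (ii) is the case
    where the first class is empty, so that its members are all flat modules.
    Part (iii) is the case where [Q'] contains all modules, once projective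
    modules are known to be Mittag-Leffler ([projective_mittag_leffler], by
    dual bases) and countably presented flat Mittag-Leffler modules to be
    projective ([countably_presented_projective]).  For the latter, build a
    sequence as above that exhausts [M] and whose [B_k] detect all modules;
    testing on the cokernel of [B_{k+1} B_k] gives [B_k = C_k B_{k+1} B_k], and
    the [C_k] correct a lifting stage by stage. *)

(** * Submodules, quotients and generators of free modules *)

Section SubQuotient.
Variables (S : pzRingType) (V : lmodType S) (U : V -> Prop).
Hypotheses (U0 : U 0) (UP : forall a u v, U u -> U v -> U (a *: u + v)).

Definition submod_mem : {pred V} := fun x => `[< U x >].

Lemma submod_mem_closed : submod_closed submod_mem.
Proof.
split=> [|a u v]; rewrite !unfold_in /submod_mem; first exact/asboolP.
by move=> /asboolP Uu /asboolP Uv; apply/asboolP/UP.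
Qed.

(** The closure proof is an argument of the predicate, so that the algebraic
    instances below are found for it by unification. *)
Definition submod_pred of submod_closed submod_mem : {pred V} := submod_mem.

HB.instance Definition _ (h : submod_closed submod_mem) :=
  GRing.isSubmodClosed.Build S V (submod_pred h) h.

Local Notation P := (submod_pred submod_mem_closed).

Record submod := Submod { submod_val : V; submod_valP : submod_val \in P }.

HB.instance Definition _ := [isSub for submod_val].
HB.instance Definition _ := [Choice of submod by <:].
HB.instance Definition _ := [SubChoice_isSubLmodule of submod by <:].

Lemma submod_exists : exists (L : lmodType S) (i : {linear L -> V}),
  injective i /\ (forall x, U x <-> exists y, i y = x).
Proof.
exists submod, (val : {linear submod -> V}); split; first exact: val_inj.
move=> x; split=> [Ux|[[y yP] <-]]; last exact/asboolP.
have xP : x \in P by exact/asboolP.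
by exists (Submod xP).
Qed.

Definition quotmod : Type := Quotient.quot P.
HB.instance Definition _ := GRing.Zmodule.on quotmod.

Definition quotmod_pi (x : V) : quotmod := \pi_(Quotient.quot P) x.

Lemma quotmod_pi_eq x y : quotmod_pi x = quotmod_pi y <-> U (x - y).
Proof.
split=> [/eqP|xy]; first by rewrite -Quotient.idealrBE => /asboolP.
by apply/eqP; rewrite -Quotient.idealrBE; apply/asboolP.
Qed.

Lemma quotmod_piD x y : quotmod_pi (x + y) = quotmod_pi x + quotmod_pi y.
Proof. exact: raddfD. Qed.

Lemma quotmod_reprK x : quotmod_pi (repr x) = x.
Proof. exact: reprK. Qed.

Definition quotmod_scale (a : S) (x : quotmod) : quotmod :=
  quotmod_pi (a *: repr x).

Lemma quotmod_scaleE a x : quotmod_scale a (quotmod_pi x) = quotmod_pi (a *: x).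
Proof.
apply/quotmod_pi_eq; rewrite -scalerBr -[_ *: _]addr0; apply: UP => //.
by apply/quotmod_pi_eq; rewrite quotmod_reprK.
Qed.

Lemma quotmod_scaleA a b x :
  quotmod_scale a (quotmod_scale b x) = quotmod_scale (a * b) x.
Proof. by rewrite -[x]quotmod_reprK !quotmod_scaleE scalerA. Qed.
Lemma quotmod_scale1 : left_id 1 quotmod_scale.
Proof. by move=> x; rewrite -[x]quotmod_reprK !quotmod_scaleE scale1r. Qed.
Lemma quotmod_scaleDr : right_distributive quotmod_scale +%R.
Proof.
move=> a x y; rewrite -[x]quotmod_reprK -[y]quotmod_reprK.
by rewrite -quotmod_piD !quotmod_scaleE -quotmod_piD scalerDr.
Qed.
Lemma quotmod_scaleDl x : {morph quotmod_scale^~ x : a b / a + b}.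
Proof.
move=> a b; rewrite -[x]quotmod_reprK !quotmod_scaleE -quotmod_piD.
by rewrite scalerDl.
Qed.

HB.instance Definition _ := GRing.Zmodule_isLmodule.Build S quotmod
  quotmod_scaleA quotmod_scale1 quotmod_scaleDr quotmod_scaleDl.

Lemma quotmod_pi_linear : linear quotmod_pi.
Proof. by move=> a x y; rewrite quotmod_piD -quotmod_scaleE. Qed.

HB.instance Definition _ :=
  GRing.isLinear.Build S V quotmod *:%R quotmod_pi quotmod_pi_linear.

Lemma quotmod_exists : exists (W : lmodType S) (p : {linear V -> W}),
  (forall x, p x = 0 <-> U x) /\ (forall y, exists x, p x = y).
Proof.
exists quotmod, (quotmod_pi : {linear V -> quotmod}); split=> [x|y].
  rewrite -[0](raddf0 (quotmod_pi : {linear V -> quotmod})) /=.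
  by rewrite -[in X in _ <-> X](subr0 x); exact: quotmod_pi_eq.
by exists (repr y); exact: quotmod_reprK.
Qed.

End SubQuotient.

Lemma free_mod_ind (S : pzRingType) (X : choiceType)
    (P : free_mod S X -> Prop) :
  P 0 -> (forall u v, P u -> P v -> P (u + v)) ->
  (forall a x, P (a *: free_gen S x)) -> forall u, P u.
Proof.
move=> P0 PD PZ u; have finu := free_mod_finite u.
suff -> : u = free_lift (@free_gen S X) u.
  rewrite (free_liftE _ finu)// fsbig_finite//=.
  by elim/big_ind: _.
apply: val_inj; apply: functional_extensionality_dep => y /=.
rewrite (free_liftE _ finu)// fsbig_finite//=.
have sumE (r : seq X) :
    (\sum_(i <- r) (u i : S) *: (free_gen S i : free_mod S X)) y =
    \sum_(i <- r) (u i : S) * (y == i)%:R.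
  by elim: r => [|i r IHr]; rewrite ?big_nil// !big_cons -IHr.
rewrite sumE; have [uy|uy] := eqVneq (u y) 0.
  rewrite uy big1// => i _; case: eqP => [<-|]; last by rewrite mulr0.
  by rewrite uy mul0r.
rewrite (bigD1_seq y) ?finmap.fset_uniq//=; last first.
  by rewrite in_fset_set// inE; exact/eqP.
rewrite eqxx mulr1 big1 ?addr0// => i /negPf iy.
by rewrite eq_sym iy mulr0.
Qed.

Lemma free_int_ind (X : choiceType) (P : free_mod int X -> Prop) :
  P 0 -> (forall u v, P u -> P v -> P (u - v)) ->
  (forall x, P (free_gen int x)) -> forall u, P u.
Proof.
move=> P0 PB Pgen; have PN u : P u -> P (- u).
  by move=> Pu; rewrite -sub0r; apply: PB.
have PD u v : P u -> P v -> P (u + v).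
  by move=> Pu Pv; rewrite -[v]opprK; apply: PB => //; apply: PN.
apply: free_mod_ind => // a x.
have Pn n : P (n%:Z *: free_gen int x).
  elim: n => [|n IHn]; first by rewrite scale0r.
  by rewrite intS scalerDl scale1r; apply: PD.
case: a => n; first exact: Pn.
by rewrite NegzE scaleNr; apply/PN/Pn.
Qed.

Lemma linear_exists (S : pzRingType) (V W : lmodType S) (f : V -> W) :
  linear f -> exists g : {linear V -> W}, forall x, g x = f x.
Proof.
move=> fL; pose H := GRing.isLinear.Build S V W *:%R f fL.
by pose g : {linear V -> W} := HB.pack f H; exists g.
Qed.

(** * Matrices acting on tuples *)

Lemma zprod_sumE (I J : Type) (V : I -> zmodType) (r : seq J)
    (g : J -> zprod V) i :
  (\sum_(j <- r) g j) i = \sum_(j <- r) g j i.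
Proof. by elim: r => [|j r IHr]; rewrite ?big_nil// !big_cons -IHr. Qed.

Lemma lprod_sumE (S : pzRingType) (I J : Type) (V : I -> lmodType S)
    (r : seq J) (g : J -> lprod V) i :
  (\sum_(j <- r) g j) i = \sum_(j <- r) g j i.
Proof. exact: (@zprod_sumE I J V). Qed.

Section Tuples.
Variable R : pzRingType.

(** A tuple [m] of a right module is a row and a tuple [q] of a left module is
    a column: [rcomb m B] is the product [m B] and [lcomb B q] is [B q]. *)
Definition rcomb (M : rmodType R) k n (m : 'I_k -> M) (B : 'M[R]_(k, n)) :
  'I_n -> M := fun j => \sum_i (B i j : R^c) *: m i.

Definition lcomb (A : lmodType R) k n (B : 'M[R]_(k, n)) (q : 'I_n -> A) :
  'I_k -> A := fun i => \sum_j B i j *: q j.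

Definition tcat T k n (f : 'I_k -> T) (g : 'I_n -> T) (i : 'I_(k + n)) : T :=
  match fintype.split i with inl j => f j | inr j => g j end.

Lemma tcatl T k n (f : 'I_k -> T) (g : 'I_n -> T) i :
  tcat f g (lshift n i) = f i.
Proof. by rewrite /tcat (unsplitK (inl _ i)). Qed.

Lemma tcatr T k n (f : 'I_k -> T) (g : 'I_n -> T) i :
  tcat f g (rshift k i) = g i.
Proof. by rewrite /tcat (unsplitK (inr _ i)). Qed.

Section Right.
Variable M : rmodType R.

Lemma rcombA k l n (m : 'I_k -> M) (B : 'M[R]_(k, l)) (C : 'M[R]_(l, n)) :
  rcomb (rcomb m B) C = rcomb m (B *m C).
Proof.
apply: funext => j; rewrite /rcomb.
under eq_bigr do rewrite scaler_sumr.
rewrite exchange_big; apply: eq_bigr => i _; rewrite mxE scaler_suml.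
by apply: eq_bigr => h _; rewrite scalerA.
Qed.

Lemma rcomb1 n (m : 'I_n -> M) : rcomb m 1%:M = m.
Proof.
apply: funext => j; rewrite /rcomb (bigD1 j)//= big1 ?mxE ?eqxx ?scale1r ?addr0//.
by move=> i /negPf ij; rewrite mxE ij scale0r.
Qed.

Lemma rcombB k n (m : 'I_k -> M) (B C : 'M[R]_(k, n)) :
  rcomb m (B - C) = rcomb m B - rcomb m C.
Proof.
apply: funext => j; rewrite /rcomb !fctE -sumrB; apply: eq_bigr => i _.
by rewrite !mxE scalerBl.
Qed.

Lemma rcombD k n (m : 'I_k -> M) (B C : 'M[R]_(k, n)) :
  rcomb m (B + C) = rcomb m B + rcomb m C.
Proof.
apply: funext => j; rewrite /rcomb !fctE -big_split; apply: eq_bigr => i _.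
by rewrite !mxE scalerDl.
Qed.

Lemma rcomb0 k n (m : 'I_k -> M) : rcomb m (0 : 'M[R]_(k, n)) = 0.
Proof. by rewrite -[0](subrr 0) rcombB subrr. Qed.

Lemma rcomb0l k n (B : 'M[R]_(k, n)) : rcomb (0 : 'I_k -> M) B = 0.
Proof.
by apply: funext => j; rewrite /rcomb big1// => i _; rewrite scaler0.
Qed.

Lemma rcomb_scalar (m : 'I_1 -> M) (a : R) :
  rcomb m a%:M ord0 = (a : R^c) *: m ord0.
Proof. by rewrite /rcomb big_ord1 mxE eqxx. Qed.

Lemma rcombBl k n (m m' : 'I_k -> M) (B : 'M[R]_(k, n)) :
  rcomb (m - m') B = rcomb m B - rcomb m' B.
Proof.
apply: funext => j; rewrite /rcomb !fctE -sumrB; apply: eq_bigr => i _.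
by rewrite scalerBr.
Qed.

Lemma rcombNl k n (m : 'I_k -> M) (B : 'M[R]_(k, n)) :
  rcomb (- m) B = - rcomb m B.
Proof.
apply: funext => j; rewrite /rcomb !fctE -sumrN; apply: eq_bigr => i _.
by rewrite scalerN.
Qed.

Lemma rcomb_tcat k l n (m : 'I_k -> M) (m' : 'I_l -> M) (B : 'M[R]_(k, n))
    (B' : 'M[R]_(l, n)) :
  rcomb (tcat m m') (col_mx B B') = rcomb m B + rcomb m' B'.
Proof.
apply: funext => j; rewrite /rcomb fctE big_split_ord; congr (_ + _);
  by apply: eq_bigr => i _; rewrite ?tcatl ?tcatr ?col_mxEu ?col_mxEd.
Qed.

Lemma rcomb_linear (M' : rmodType R) (f : {linear M -> M'}) k n
  (m : 'I_k -> M) (B : 'M[R]_(k, n)) : f \o rcomb m B = rcomb (f \o m) B.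
Proof.
apply: funext => j; rewrite /rcomb /= linear_sum.
by apply: eq_bigr => i _; rewrite linearZ.
Qed.

End Right.

Section Left.
Variable A : lmodType R.

Lemma lcombA k l n (B : 'M[R]_(k, l)) (C : 'M[R]_(l, n)) (q : 'I_n -> A) :
  lcomb B (lcomb C q) = lcomb (B *m C) q.
Proof.
apply: funext => i; rewrite /lcomb.
under eq_bigr do rewrite scaler_sumr.
rewrite exchange_big; apply: eq_bigr => j _; rewrite mxE scaler_suml.
by apply: eq_bigr => h _; rewrite scalerA.
Qed.

Lemma lcomb1 n (q : 'I_n -> A) : lcomb 1%:M q = q.
Proof.
apply: funext => j; rewrite /lcomb (bigD1 j)//= big1 ?mxE ?eqxx ?scale1r ?addr0//.
by move=> i /negPf ij; rewrite mxE eq_sym ij scale0r.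
Qed.

Lemma lcombBl k n (B C : 'M[R]_(k, n)) (q : 'I_n -> A) :
  lcomb (B - C) q = lcomb B q - lcomb C q.
Proof.
apply: funext => i; rewrite /lcomb !fctE -sumrB; apply: eq_bigr => j _.
by rewrite !mxE scalerBl.
Qed.

Lemma lcomb_col k l n (B : 'M[R]_(k, n)) (B' : 'M[R]_(l, n)) (q : 'I_n -> A) :
  lcomb (col_mx B B') q = tcat (lcomb B q) (lcomb B' q).
Proof.
apply: funext => i; rewrite /tcat; case: split_ordP => h ->;
  by apply: eq_bigr => j _; rewrite ?col_mxEu ?col_mxEd.
Qed.

Lemma lcomb0 k n (B : 'M[R]_(k, n)) : lcomb B (0 : 'I_n -> A) = 0.
Proof. by apply: funext => i; rewrite /lcomb big1// => j _; rewrite scaler0. Qed.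

Lemma lcomb0l k n (q : 'I_n -> A) : lcomb (0 : 'M[R]_(k, n)) q = 0.
Proof. by rewrite -[0](subrr 0) lcombBl subrr. Qed.

Lemma lcomb_linear (A' : lmodType R) (f : {linear A -> A'}) k n
  (B : 'M[R]_(k, n)) (q : 'I_n -> A) : f \o lcomb B q = lcomb B (f \o q).
Proof.
apply: funext => i; rewrite /lcomb /= linear_sum.
by apply: eq_bigr => j _; rewrite linearZ.
Qed.

End Left.

(** A matrix seen as a tuple of a free left module, so that statements about
    tuples apply to matrix products. *)
Definition mxrows k n (B : 'M[R]_(k, n)) : 'I_k -> 'rV[R]_n := fun i => row i B.

Lemma mxrows_lcomb k l n (B : 'M[R]_(k, l)) (C : 'M[R]_(l, n)) :
  mxrows (B *m C) = lcomb B (mxrows C).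
Proof.
apply: funext => i; apply/rowP => j; rewrite /mxrows /lcomb summxE !mxE.
by apply: eq_bigr => h _; rewrite !mxE.
Qed.

Lemma mxrows_inj k n : injective (@mxrows k n).
Proof.
by move=> B C BC; apply/row_matrixP => i; have /(congr1 (@^~ i)) := BC.
Qed.

Lemma mxrows0 k n : mxrows (0 : 'M[R]_(k, n)) = 0.
Proof. by apply: funext => i; rewrite /mxrows row0. Qed.

Lemma mxrows_eq0 k n (B : 'M[R]_(k, n)) : mxrows B = 0 -> B = 0.
Proof. by rewrite -(mxrows0 k n) => /mxrows_inj. Qed.

Lemma mxrowsE k n (B : 'M[R]_(k, n)) : mxrows B = lcomb B (mxrows 1%:M).
Proof. by rewrite -mxrows_lcomb mulmx1. Qed.

Section Tensors.
Variables (M : rmodType R) (A : lmodType R).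

Definition tens n (m : 'I_n -> M) (q : 'I_n -> A) : tensor M A :=
  \sum_i pure (m i) (q i).

Lemma pureDl (m m' : M) (q : A) : pure (m + m') q = pure m q + pure m' q.
Proof. by have [] := @pure_balanced R M A. Qed.
Lemma pureDr (m : M) (q q' : A) : pure m (q + q') = pure m q + pure m q'.
Proof. by have [] := @pure_balanced R M A. Qed.
Lemma pureZ (m : M) (r : R) (q : A) : pure ((r : R^c) *: m) q = pure m (r *: q).
Proof. by have [] := @pure_balanced R M A. Qed.
Lemma pure0l (q : A) : pure (0 : M) q = 0.
Proof. by apply: (addrI (pure 0 q)); rewrite -pureDl !addr0. Qed.
Lemma pure0r (m : M) : pure m (0 : A) = 0.
Proof. by apply: (addrI (pure m 0)); rewrite -pureDr !addr0. Qed.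
Lemma pureNl (m : M) (q : A) : pure (- m) q = - pure m q.
Proof. by apply: (addrI (pure m q)); rewrite -pureDl !subrr pure0l. Qed.

Lemma tens_rcomb k n (m : 'I_k -> M) (B : 'M[R]_(k, n)) (q : 'I_n -> A) :
  tens (rcomb m B) q = tens m (lcomb B q).
Proof.
have suml (I : Type) (r : seq I) (f : I -> M) (a : A) :
    pure (\sum_(i <- r) f i) a = \sum_(i <- r) pure (f i) a.
  exact: (big_morph (fun x => pure x a) (fun x y => pureDl x y a) (pure0l a)).
have sumr (I : Type) (r : seq I) (f : I -> A) (a : M) :
    pure a (\sum_(i <- r) f i) = \sum_(i <- r) pure a (f i).
  exact: (big_morph (pure a) (pureDr a) (pure0r a)).
rewrite /tens /rcomb /lcomb; under eq_bigr do rewrite suml.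
rewrite exchange_big; apply: eq_bigr => i _; rewrite sumr.
by apply: eq_bigr => j _; rewrite pureZ.
Qed.

Lemma tens0r n (m : 'I_n -> M) : tens m (0 : 'I_n -> A) = 0.
Proof. by rewrite /tens big1// => i _; rewrite pure0r. Qed.

Lemma tens0l n (q : 'I_n -> A) : tens (0 : 'I_n -> M) q = 0.
Proof. by rewrite /tens big1// => i _; rewrite pure0l. Qed.

Lemma tensP (t : tensor M A) : exists n (m : 'I_n -> M) (q : 'I_n -> A), t = tens m q.
Proof.
have tensB n p (m : 'I_n -> M) (q : 'I_n -> A) (m' : 'I_p -> M) q' :
    exists k (m1 : 'I_k -> M) (q1 : 'I_k -> A),
      tens m q - tens m' q' = tens m1 q1.
  exists (n + p)%N, (tcat m (- m')), (tcat q q').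
  rewrite /tens big_split_ord/= -sumrN; congr (_ + _); apply: eq_bigr => i _.
    by rewrite !tcatl.
  by rewrite !tcatr pureNl.
rewrite -[t]tensor_classK; elim/free_int_ind: (repr t) => [|u v|[m q]].
- by exists 0%N, 0, 0; rewrite raddf0 tens0r.
- move=> [n [m [q mq]]] [n' [m' [q' mq']]]; rewrite raddfB /= mq mq'.
  exact: tensB.
- by exists 1%N, (fun=> m), (fun=> q); rewrite /tens big_ord1.
Qed.

(** The universal property of the tensor product for maps that are balanced only
    modulo a subgroup [W].  Typically [f] computes with chosen representatives of
    the elements of a quotient or image, and [W] absorbs the choices. *)
Lemma tens_eq0_mod (V : zmodType) (W : V -> Prop) (f : M -> A -> V) :
  W 0 -> (forall x y, W x -> W y -> W (x - y)) ->
  (forall m m' q, W (f (m + m') q - (f m q + f m' q))) ->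
  (forall m q q', W (f m (q + q') - (f m q + f m q'))) ->
  (forall m (r : R) q, W (f ((r : R^c) *: m) q - f m (r *: q))) ->
  forall n (m : 'I_n -> M) (q : 'I_n -> A),
    tens m q = 0 -> W (\sum_i f (m i) (q i)).
Proof.
move=> W0 WB WDl WDr WZ n m q.
pose F := @free_lift int _ (zmodule V) (fun p : M * A => f p.1 p.2).
have FG m' q' : F (tensor_gen m' q') = f m' q' by exact: free_lift_gen.
have FW z : tensor_rel z -> W (F z).
  elim=> [m1 m2 q1|m1 q1 q2|m1 r q1||x y _ Wx _ Wy].
  - by rewrite /F raddfB raddfD /= -/F !FG.
  - by rewrite /F raddfB raddfD /= -/F !FG.
  - by rewrite /F raddfB /= -/F !FG.
  - by rewrite /F raddf0.
  - by rewrite /F raddfB; apply: WB.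
have -> : tens m q = tensor_class (\sum_i tensor_gen (m i) (q i)).
  by rewrite raddf_sum.
move=> z0; have /tensor_classP : tensor_class (\sum_i tensor_gen (m i) (q i)) =
  tensor_class 0 :> tensor M A by rewrite raddf0.
rewrite subr0 => /FW; rewrite /F raddf_sum /= -/F.
by under eq_bigr do rewrite FG.
Qed.

End Tensors.

Lemma tens_mxrows (M : rmodType R) k n (m : 'I_k -> M) (B : 'M[R]_(k, n)) :
  rcomb m B = 0 -> tens m (mxrows B) = 0.
Proof. by move=> mB0; rewrite mxrowsE -tens_rcomb mB0 tens0l. Qed.

Lemma tens_map (M : rmodType R) (A A' : lmodType R) (f : {linear A -> A'}) n
    (m : 'I_n -> M) (q : 'I_n -> A) :
  tensor_map f (tens m q) = tens m (f \o q).
Proof.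
have tm0 : tensor_map (M := M) f 0 = 0.
  by rewrite -(pure0l M 0) tensor_map_pure linear0 pure0r.
have tmD : {morph tensor_map (M := M) f : t u / t + u}.
  move=> t u; have tmB := tensor_map_is_zmod_morphism f (M := M).
  by rewrite -[u in LHS]opprK -[- u]sub0r !tmB tm0 sub0r opprK.
rewrite /tens (big_morph _ tmD tm0).
by apply: eq_bigr => i _; rewrite tensor_map_pure.
Qed.

Lemma tens_prod (M : rmodType R) (I : Type) (N : I -> lmodType R) n
    (m : 'I_n -> M) (q : 'I_n -> lprod N) :
  tensor_prod (tens m q) = fun i => tens m (fun j => q j i).
Proof.
have tp0 : tensor_prod (M := M) (Q := N) 0 = 0.
  have := @tensor_prod_is_zmod_morphism R M I N 0 0.
  by rewrite !subrr.
have tpD : {morph tensor_prod (M := M) (Q := N) : t u / t + u}.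
  move=> t u; have tpB := @tensor_prod_is_zmod_morphism R M I N.
  by rewrite -[u in LHS]opprK -[- u]sub0r !tpB tp0 sub0r opprK.
rewrite {1}/tens (big_morph _ tpD tp0).
apply: functional_extensionality_dep => i.
by rewrite zprod_sumE; apply: eq_bigr => j _; rewrite tensor_prod_pure.
Qed.

End Tuples.

(** * Flat Mittag-Leffler modules and factorizations of tuples *)

Section Criterion.
Variable R : pzRingType.

(** Let [L] be the submodule generated by the [q_j], the image of [R^n].  By
    flatness the relation already holds in [M (x) L].  Sending [y (x) l] to
    [y s(l)], with [s(l)] any coefficients expressing [l], is balanced modulo the
    subgroup [W] of [M^n] generated by the [m' b] with [b] a relation between the
    [q_j].  So [m] lies in [W], which is a factorization of the required kind. *)
Lemma flat_tens_eq0 (M : rmodType R) (A : lmodType R) n (m : 'I_n -> M)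
    (q : 'I_n -> A) :
  flat M -> tens m q = 0 ->
  exists k (m' : 'I_k -> M) (B : 'M[R]_(k, n)),
    m = rcomb m' B /\ lcomb B q = 0.
Proof.
move=> flM mq0; pose comb (r : 'rV[R]_n) : A := lcomb r q ord0.
have combP a r r' : comb (a *: r + r') = a *: comb r + comb r'.
  rewrite /comb /lcomb scaler_sumr -big_split; apply: eq_bigr => j _ /=.
  by rewrite !mxE scalerDl scalerA.
pose U (x : A) := exists r, x = comb r.
have U0 : U 0.
  by exists 0; rewrite /comb /lcomb big1// => j _; rewrite mxE scale0r.
have UP a x y : U x -> U y -> U (a *: x + y).
  by move=> [r ->] [r' ->]; exists (a *: r + r'); rewrite combP.
have [L [i [i_inj iU]]] := submod_exists U0 UP.
have /choice[l il] j : exists x, i x = q j.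
  apply/iU; exists (row j 1%:M); transitivity (lcomb 1%:M q j).
    by rewrite lcomb1.
  by apply: eq_bigr => h _; rewrite [in RHS]mxE.
have /choice[s is_] x : exists r, i x = comb r by apply/iU; exists x.
pose W (v : 'I_n -> M) := exists k (m' : 'I_k -> M) (B : 'M[R]_(k, n)),
  v = rcomb m' B /\ lcomb B q = 0.
have W0 : W 0.
  exists 0%N, 0, 0; split; last by apply: funext; case.
  by apply: funext => j; rewrite /rcomb big_ord0.
have WB u v : W u -> W v -> W (u - v).
  move=> [k [m1 [B [-> Bq]]]] [k' [m2 [B' [-> Bq']]]].
  exists (k + k')%N, (tcat m1 (- m2)), (col_mx B B').
  rewrite rcomb_tcat rcombNl lcomb_col Bq Bq'; split=> //.
  by apply: funext => j; rewrite /tcat; case: fintype.split.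
have Wgen m' r : comb r = 0 -> W (fun j => (r ord0 j : R^c) *: m').
  move=> r0; exists 1%N, (fun=> m'), r; split.
    by apply: funext => j; rewrite /rcomb big_ord1.
  by apply: funext => j; rewrite ord1.
pose f (m' : M) (x : L) : 'I_n -> M := fun j => (s x ord0 j : R^c) *: m'.
have comb0 : comb 0 = 0.
  by rewrite /comb /lcomb big1// => j _; rewrite mxE scale0r.
have combB r r' : comb (r - r') = comb r - comb r'.
  by rewrite -[- r']scaleN1r [r + _]addrC combP scaleN1r addrC.
have combZ a r : comb (a *: r) = a *: comb r.
  by rewrite -[a *: r]addr0 combP comb0 addr0.
have ml0 : tens m l = 0.
  apply: (flM _ _ i i_inj); rewrite -(tens0l _ (0 : 'I_0 -> L)) !tens_map.
  rewrite tens0l -[RHS]mq0; congr tens; exact/funext.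
have WS : W (\sum_j f (m j) (l j)).
  apply: (tens_eq0_mod W0 WB _ _ _ ml0) => [m1 m2 x|m1 x y|m1 r x].
  - rewrite (_ : _ - _ = 0)//; apply: funext => j; rewrite !fctE /f.
    by rewrite scalerDr subrr.
  - rewrite (_ : _ - _ = fun j => ((s (x + y) - (s x + s y)) ord0 j : R^c) *: m1).
      apply: Wgen; rewrite combB -[s x]scale1r combP scale1r -!is_.
      by rewrite linearD subrr.
    by apply: funext => j; rewrite !fctE /f !mxE scalerBl scalerDl.
  - rewrite (_ : _ - _ = fun j => ((r *: s x - s (r *: x)) ord0 j : R^c) *: m1).
      by apply: Wgen; rewrite combB combZ -!is_ linearZ subrr.
    by apply: funext => j; rewrite !fctE /f !mxE scalerBl scalerA.
pose C : 'M[R]_n := \matrix_(j, h) s (l j) ord0 h.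
have fC : \sum_j f (m j) (l j) = rcomb m C.
  apply: funext => h; rewrite fct_sumE; apply: eq_bigr => j _.
  by rewrite /f mxE.
have Cq : lcomb C q = q.
  apply: funext => j; rewrite -[RHS]il is_ /comb /lcomb.
  by apply: eq_bigr => h _; rewrite mxE.
rewrite (_ : m = rcomb m C - rcomb m (C - 1%:M)); last first.
  by rewrite rcombB rcomb1 opprB addrC subrK.
apply: WB; first by rewrite -fC.
exists n, m, (C - 1%:M); split=> //.
by rewrite lcombBl Cq lcomb1 subrr.
Qed.

(** When [m] factors through [B], the vanishing of [lcomb B q] always implies
    that of [tens m q]; here the converse is required, uniformly in [Q].  This is
    the Mittag-Leffler condition in terms of matrices. *)
Definition detects (Q : lmodType R -> Prop) (M : rmodType R) k n
    (m : 'I_n -> M) (B : 'M[R]_(k, n)) : Prop :=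
  forall A : lmodType R, Q A -> forall q : 'I_n -> A,
    tens m q = 0 -> lcomb B q = 0.

Lemma factor_mittag_leffler (Q : lmodType R -> Prop) (M : rmodType R) :
  (forall n (m : 'I_n -> M), exists k (m' : 'I_k -> M) (B : 'M[R]_(k, n)),
     m = rcomb m' B /\ detects Q m B) ->
  mittag_leffler_for Q M.
Proof.
move=> H I N QN; have tpB := @tensor_prod_is_zmod_morphism R M I N.
suff tp0 (t : tensor M (lprod N)) : tensor_prod t = 0 -> t = 0.
  by move=> t u tu; apply: subr0_eq; apply: tp0; rewrite tpB tu subrr.
have [n [m [q ->]]] := tensP t; rewrite tens_prod => mq0.
have [k [m' [B [mE detB]]]] := H n m.
rewrite {1}mE tens_rcomb (_ : lcomb B q = 0) ?tens0r//.
apply: funext => h; apply: functional_extensionality_dep => i.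
have mqi0 : tens m (fun j => q j i) = 0 by exact: (congr1 (@^~ i) mq0).
transitivity (lcomb B (fun j => q j i) h); last by rewrite (detB _ (QN i)).
by rewrite /lcomb lprod_sumE.
Qed.

(** If each factorization [i] of [m] misses some [q_i] from [Q], the product of
    these tuples pairs to zero with [m], being zero in every component.  By
    flatness a single factorization kills the whole product, hence also the
    component that it was supposed to miss. *)
Lemma mittag_leffler_factor (Q : lmodType R -> Prop) (M : rmodType R) n
    (m : 'I_n -> M) :
  flat_ML_for Q M -> exists k (m' : 'I_k -> M) (B : 'M[R]_(k, n)),
     m = rcomb m' B /\ detects Q m B.
Proof.
move=> [flM MLM]; apply: contrapT => /forallNP Hbad.
(* The index set consists of matrices, so it is small even when [Q] is a proper
   class. *)
pose bad (i : {k & 'M[R]_(k, n)}) := exists m', m = rcomb m' (projT2 i).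
have witness (i : {i | bad i}) : exists A : lmodType R,
    Q A /\ exists q : 'I_n -> A, tens m q = 0 /\ lcomb (projT2 (sval i)) q <> 0.
  case: i => -[k B] [m' /= mE]; apply: contrapT => Hno; apply: (Hbad k).
  exists m', B; split=> // A QA q mq0; apply: contrapT => Bq.
  by apply: Hno; exists A; split=> //; exists q.
pose N i := sval (cid (witness i)).
have QN i : Q (N i) by case: (svalP (cid (witness i))).
have Nq i : exists q : 'I_n -> N i,
    tens m q = 0 /\ lcomb (projT2 (sval i)) q <> 0.
  by case: (svalP (cid (witness i))).
pose q (j : 'I_n) : lprod N := fun i => sval (cid (Nq i)) j.
have mq0 : tens m q = 0.
  apply: (MLM _ N QN); rewrite -[in RHS](tens0l M (0 : 'I_0 -> lprod N)) !tens_prod.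
  apply: functional_extensionality_dep => i; rewrite tens0l.
  by case: (svalP (cid (Nq i))).
have [k [m' [B [mE Bq]]]] := flat_tens_eq0 flM mq0.
have badB : bad (existT _ k B) by exists m'.
pose i : {i | bad i} := exist _ _ badB.
case: (svalP (cid (Nq i))) => _; apply; apply: funext => h.
transitivity (lcomb B q h i); last by rewrite Bq.
by rewrite /lcomb lprod_sumE.
Qed.

End Criterion.

(** * Colimits of sequences of finite free modules *)

Section Telescope.
Variables (R : pzRingType) (n : nat -> nat).
Variable B : forall k, 'M[R]_(n k.+1, n k).

(** The composites of consecutive matrices.  Recursion on the target keeps the
    dimensions convertible; a product indexed by the number of factors would
    need casts. *)
Inductive trans : forall k j, 'M[R]_(n j, n k) -> Prop :=
| trans_refl k : @trans k k 1%:M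
| trans_step k j (X : 'M[R]_(n j, n k)) :
    @trans k j X -> @trans k j.+1 (B j *m X).

Lemma trans_exists k j : (k <= j)%N -> exists X, @trans k j X.
Proof.
elim: j => [|j IHj]; first by rewrite leqn0 => /eqP ->; exists 1%:M; constructor.
rewrite leq_eqVlt => /orP[/eqP ->|]; first by exists 1%:M; constructor.
by rewrite ltnS => /IHj[X trX]; exists (B j *m X); constructor.
Qed.

Lemma trans_comp k l j (X : 'M[R]_(n j, n l)) (Y : 'M[R]_(n l, n k)) :
  @trans l j X -> @trans k l Y -> @trans k j (X *m Y).
Proof.
move=> trX; elim: trX Y => {l j X} [l|l j X _ IH] Y trY; first by rewrite mul1mx.
by rewrite -mulmxA; constructor; apply: IH.
Qed.

Lemma trans_next k : @trans k k.+1 (B k).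
Proof. by rewrite -[B k]mulmx1; do 2!constructor. Qed.

Definition thread (M : rmodType R) (m : forall k, 'I_(n k) -> M) : Prop :=
  forall k, m k = rcomb (m k.+1) (B k).

Definition exhausts (M : rmodType R) (m : forall k, 'I_(n k) -> M) : Prop :=
  forall z : M, exists k (c : 'cV[R]_(n k)), z = rcomb (m k) c ord0.

Lemma thread_trans (M : rmodType R) (m : forall k, 'I_(n k) -> M) k j X :
  thread m -> @trans k j X -> m k = rcomb (m j) X.
Proof.
move=> mT; elim=> {k j X} [k|k j X _ ->]; first by rewrite rcomb1.
by rewrite [in LHS]mT rcombA.
Qed.

Lemma exhausts_tuple (M : rmodType R) (m : forall k, 'I_(n k) -> M) p
    (x : 'I_p -> M) :
  thread m -> exhausts m -> exists k (A : 'M[R]_(n k, p)), x = rcomb (m k) A.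
Proof.
move=> mT mE; have /choice[K KP] h := mE (x h).
pose k := (\max_h K h)%N; exists k.
have /choice[c cP] h : exists c : 'cV[R]_(n k), x h = rcomb (m k) c ord0.
  have [c ->] := KP h; have [X trX] := trans_exists (leq_bigmax h : K h <= k)%N.
  by exists (X *m c); rewrite (thread_trans mT trX) rcombA.
exists (\matrix_(i, h) c h i ord0); apply: funext => h; rewrite cP.
by apply: eq_bigr => i _; rewrite mxE.
Qed.

(** The elements of the form [rcomb (m k) c] make up a submodule, because any
    two of them can be moved to a common stage. *)
Lemma exhausts_gen (M : rmodType R) (m : forall k, 'I_(n k) -> M)
    (X : choiceType) (g : {linear free_mod R^c X -> M}) :
  thread m -> (forall z, exists u, g u = z) ->
  (forall x, exists k (c : 'cV[R]_(n k)),
     g (free_gen R^c x) = rcomb (m k) c ord0) ->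
  exhausts m.
Proof.
move=> mT g_surj gen z; have [u <-] := g_surj z.
elim/free_mod_ind: u => [|u v [k [c uE]] [k' [c' vE]]|a x].
- by exists 0%N, 0; rewrite linear0 rcomb0.
- have [X1 tr1] := trans_exists (leq_maxl k k').
  have [X2 tr2] := trans_exists (leq_maxr k k').
  exists (maxn k k'), (X1 *m c + X2 *m c'); rewrite linearD uE vE.
  by rewrite (thread_trans mT tr1) (thread_trans mT tr2) !rcombA rcombD.
- have [k [c gE]] := gen x; exists k, (c *m (a : R)%:M).
  by rewrite linearZ -rcombA rcomb_scalar gE.
Qed.

(** The last condition says that tensoring [N] with [A] gives the colimit of the
    powers [A^(n k)].  Flatness and the Mittag-Leffler property of [N] are read
    off from these three properties, whatever the construction of [N]. *)
Definition colimit_thread (N : rmodType R) (e : forall k, 'I_(n k) -> N) : Prop :=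
  [/\ thread e, exhausts e
    & forall (A : lmodType R) k (q : 'I_(n k) -> A), tens (e k) q = 0 ->
        exists j X, @trans k j X /\ lcomb X q = 0].

(** An injective map detects the vanishing of a tuple at a given stage, and
    vanishing in the colimit is vanishing at some stage. *)
Lemma colimit_flat (N : rmodType R) (e : forall k, 'I_(n k) -> N) :
  colimit_thread e -> flat N.
Proof.
move=> [eT eE e0] A A' f f_inj.
have tmB := @tensor_map_is_zmod_morphism R N A A' f.
suff tm0 (t : tensor N A) : tensor_map f t = 0 -> t = 0.
  by move=> t u tu; apply: subr0_eq; apply: tm0; rewrite tmB tu subrr.
have [p [x [a ->]]] := tensP t; have [k [C ->]] := exhausts_tuple x eT eE.
rewrite tens_rcomb; set b := lcomb C a; rewrite tens_map => /e0[j [X [trX Xfb]]].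
rewrite (thread_trans eT trX) tens_rcomb (_ : lcomb X b = 0) ?tens0r//.
apply: funext => i; apply: f_inj; rewrite linear0.
by have /(congr1 (@^~ i)) := Xfb; rewrite -lcomb_linear.
Qed.

(** The colimit is presented by the basis vectors of all stages, subject to the
    identification of each with its image in the next stage. *)
Definition slot : countType := {k : nat & 'I_(n k)}.
Definition in_slot k (i : 'I_(n k)) : slot := existT (fun k => 'I_(n k)) k i.

Lemma in_slot_eq k (h i : 'I_(n k)) : (in_slot h == in_slot i) = (h == i).
Proof. exact: eq_Tagged. Qed.

Lemma in_slot_neq k j (h : 'I_(n k)) (i : 'I_(n j)) :
  k != j -> (in_slot h == in_slot i) = false.
Proof. by move=> kj; apply/eqP => -[E]; rewrite E eqxx in kj. Qed.

Local Notation F := (free_mod R^c slot).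
Definition gen k (i : 'I_(n k)) : F := free_gen R^c (in_slot i).

Lemma genE k (i : 'I_(n k)) s : gen i s = (s == in_slot i)%:R :> R.
Proof. by []. Qed.

Definition tele_rel (s : slot) : F :=
  gen (projT2 s) -
  \sum_h (B (projT1 s) h (projT2 s) : R^c) *: (gen h : F).
Definition tele_map : {linear F -> F} := free_lift tele_rel.

(** The generators of the stages up to [j] are pushed forward to stage [j], the
    later ones are sent to zero.  A defining relation is therefore killed in all
    but finitely many stages, which is what survives of the colimit without
    forming it. *)
Fixpoint stage j : F -> 'I_(n j) -> R :=
  match j return F -> 'I_(n j) -> R with
  | 0%N => fun u i => u (in_slot i)
  | j'.+1 => fun u i =>
      \sum_h B j' i h * stage u h + (u (in_slot i) : R)
  end.

Lemma stageS j (u : F) (i : 'I_(n j.+1)) :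
  stage u i = \sum_h B j i h * stage u h + (u (in_slot i) : R).
Proof. by []. Qed.

Lemma free_mod_lin (a : R) (u v : F) (s : slot) :
  ((a : R^c) *: u + v) s = (u s : R) * a + (v s : R) :> R.
Proof. by []. Qed.

Lemma stageP j (a : R) (u v : F) (i : 'I_(n j)) :
  stage ((a : R^c) *: u + v) i = stage u i * a + stage v i.
Proof.
elim: j i => [|j IHj] i; first exact: free_mod_lin.
rewrite !stageS free_mod_lin mulrDl addrACA mulr_suml -big_split; congr (_ + _).
by apply: eq_bigr => h _; rewrite IHj mulrDr mulrA.
Qed.

Lemma stage0 j (i : 'I_(n j)) : stage 0 i = 0.
Proof. by have := stageP (-1) 0 0 i; rewrite scaler0 addr0 mulrN1 addNr. Qed.

Lemma stageD j u v (i : 'I_(n j)) : stage (u + v) i = stage u i + stage v i.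
Proof. by have := stageP 1 u v i; rewrite scale1r mulr1. Qed.

Lemma stageZ j (a : R) u (i : 'I_(n j)) : stage ((a : R^c) *: u) i = stage u i * a.
Proof. by rewrite -[_ *: u]addr0 stageP stage0 addr0. Qed.

Lemma stageB j u v (i : 'I_(n j)) : stage (u - v) i = stage u i - stage v i.
Proof. by rewrite -scaleN1r stageD stageZ mulrN1. Qed.

Lemma stage_gen_lt k j (i : 'I_(n k)) (h : 'I_(n j)) :
  (j < k)%N -> stage (gen i) h = 0.
Proof.
elim: j h => [|j IHj] h jk; rewrite ?stageS.
  by rewrite /stage genE in_slot_neq// neq_ltn jk.
rewrite genE in_slot_neq ?addr0; last by rewrite neq_ltn jk.
by rewrite big1// => h' _; rewrite IHj ?mulr0// ltnW.
Qed.

Lemma stage_gen k j X (i : 'I_(n k)) (h : 'I_(n j)) :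
  @trans k j X -> stage (gen i) h = X h i.
Proof.
move=> trX; elim: trX i h => {k j X} [k|k j X trX IH] i h.
  rewrite mxE; case: k i h => [|k] i h.
    by rewrite /stage genE in_slot_eq.
  rewrite stageS genE in_slot_eq.
  by rewrite big1 ?add0r// => h' _; rewrite stage_gen_lt ?mulr0.
have kj : (k <= j)%N by elim: trX {IH i h} => // ? ? ? _; exact: leqW.
rewrite mxE stageS genE in_slot_neq ?addr0; last by rewrite neq_ltn ltnS kj orbT.
by apply: eq_bigr => h' _; rewrite IH.
Qed.

Lemma stage_sum j (I : Type) (r : seq I) (u : I -> F) (i : 'I_(n j)) :
  stage (\sum_(x <- r) u x) i = \sum_(x <- r) stage (u x) i.
Proof.
exact: (big_morph (fun v => stage v i) (fun u v => stageD u v i) (stage0 i)).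
Qed.

Lemma stage_rel j k (X : 'M[R]_(n j, n k.+1)) (i : 'I_(n k)) (h : 'I_(n j)) :
  @trans k.+1 j X -> stage (tele_rel (in_slot i)) h = 0.
Proof.
move=> trX; rewrite /tele_rel /= stageB stage_sum.
rewrite (stage_gen i h (trans_comp trX (trans_next k))) mxE.
under [X in _ - X]eq_bigr do rewrite stageZ (stage_gen _ _ trX).
by rewrite subrr.
Qed.

Lemma stage_map (u : F) :
  exists J, forall j, (J <= j)%N -> forall i : 'I_(n j), stage (tele_map u) i = 0.
Proof.
elim/free_mod_ind: u => [|u v [J HJ] [J' HJ']|a [k i]].
- by exists 0%N => j _ i; rewrite linear0 stage0.
- exists (maxn J J') => j; rewrite geq_max => /andP[Jj J'j] i.
  by rewrite linearD stageD HJ// HJ'// addr0.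
- exists k.+1 => j /trans_exists[X trX] h.
  rewrite linearZ /= /tele_map /= free_lift_gen stageZ.
  by rewrite (stage_rel i h trX) mul0r.
Qed.

Section Colimit.
Variables (N : rmodType R) (p : {linear F -> N}).
Hypotheses (p0 : forall u, p u = 0 <-> exists v, tele_map v = u)
  (p_surj : forall x, exists u, p u = x).

Let e k (i : 'I_(n k)) : N := p (gen i).

Lemma colimit_thread_e : thread e.
Proof.
move=> k; apply: funext => i; apply: subr0_eq; rewrite /rcomb /e.
under eq_bigr do rewrite -linearZ.
rewrite -linear_sum -linearB; apply/p0; exists (free_gen R^c (in_slot i)).
by rewrite /tele_map /= free_lift_gen.
Qed.

Lemma colimit_exhausts_e : exhausts e.
Proof.
apply: (exhausts_gen colimit_thread_e p_surj) => -[k i].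
exists k, (delta_mx i ord0); rewrite /rcomb (bigD1 i)//= mxE !eqxx scale1r.
by rewrite big1 ?addr0// => h /negPf hi; rewrite mxE hi scale0r.
Qed.

Lemma stage_ker (u : F) : p u = 0 ->
  exists J, forall j, (J <= j)%N -> forall i : 'I_(n j), stage u i = 0.
Proof. by move=> /p0[v <-]; exact: stage_map. Qed.

(** Sending [z (x) a] to the sequence of all [stage (s z) a], where [s] chooses
    representatives, is balanced up to sequences that are eventually zero. *)
Lemma colimit_tens_eq0 (A : lmodType R) k (q : 'I_(n k) -> A) :
  tens (e (k := k)) q = 0 -> exists j X, @trans k j X /\ lcomb X q = 0.
Proof.
have /choice[s sK] := p_surj.
pose V := zprod (fun j => 'I_(n j) -> A : zmodType).
pose W (v : V) := exists J, forall j, (J <= j)%N -> v j = 0.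
pose f (x : N) (a : A) : V := fun j i => stage (s x) i *: a.
have WB (v w : V) : W v -> W w -> W (v - w).
  move=> [J vJ] [J' wJ]; exists (maxn J J') => j; rewrite geq_max => /andP[Jj J'j].
  by rewrite -[LHS]/(v j - w j) vJ// wJ// subrr.
move=> /(@tens_eq0_mod R N A V W f) []//.
- by exists 0%N.
- move=> x y a; have [|J HJ] := @stage_ker (s (x + y) - (s x + s y)).
    by rewrite linearB linearD /= !sK subrr.
  exists J => j Jj; apply: funext => i.
  rewrite -[LHS]/(stage (s (x + y)) i *: a
                  - (stage (s x) i *: a + stage (s y) i *: a)).
  by rewrite -scalerDl -scalerBl -stageD -stageB HJ// scale0r.
- move=> x a b; exists 0%N => j _; apply: funext => i.
  rewrite -[LHS]/(stage (s x) i *: (a + b)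
                  - (stage (s x) i *: a + stage (s x) i *: b)).
  by rewrite scalerDr subrr.
- move=> x r a; have [|J HJ] := @stage_ker (s ((r : R^c) *: x) - (r : R^c) *: s x).
    by rewrite linearB linearZ /= !sK subrr.
  exists J => j Jj; apply: funext => i.
  rewrite -[LHS]/(stage (s ((r : R^c) *: x)) i *: a
                  - stage (s x) i *: (r *: a)).
  by rewrite scalerA -scalerBl -stageZ -stageB HJ// scale0r.
move=> J HJ; have /choice[J' HJ'] (i : 'I_(n k)) : exists J, forall j, (J <= j)%N ->
    forall h : 'I_(n j), stage (s (e i) - gen i) h = 0.
  by apply: stage_ker; rewrite linearB sK subrr.
pose j := maxn (maxn J k) (\max_i J' i).
have Jj : (J <= j)%N := leq_trans (leq_maxl J k) (leq_maxl _ _).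
have [X trX] : exists X, @trans k j X.
  exact: trans_exists (leq_trans (leq_maxr J k) (leq_maxl _ _)).
exists j, X; split=> //; rewrite -(HJ j Jj) zprod_sumE.
apply: funext => h; rewrite fct_sumE; apply: eq_bigr => i _.
have := HJ' i j (leq_trans (leq_bigmax i) (leq_maxr _ _)) h.
rewrite stageB (stage_gen i h trX) => /subr0_eq sE.
by rewrite -sE.
Qed.

End Colimit.

Lemma colimit_exists :
  exists (N : rmodType R) (e : forall k, 'I_(n k) -> N),
    countably_presented N /\ colimit_thread e.
Proof.
pose U (u : F) := exists v, tele_map v = u.
have U0 : U 0 by exists 0; rewrite linear0.
have UP a u v : U u -> U v -> U (a *: u + v).
  by move=> [u' <-] [v' <-]; exists (a *: u' + v'); rewrite linearP.
have [N [p [p0 p_surj]]] := quotmod_exists U0 UP.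
exists N, (fun k i => p (gen i)); split.
  by exists slot, slot, tele_map, p; split.
split; [exact: colimit_thread_e | exact: colimit_exhausts_e |].
by move=> A k q; exact: colimit_tens_eq0.
Qed.

End Telescope.

(** * From countably presented modules to all modules *)

Lemma dependent_choice (T : nat -> Type) (P : forall k, T k -> T k.+1 -> Prop) :
  T 0%N -> (forall k x, exists y, P k x y) ->
  exists s : forall k, T k, forall k, P k (s k) (s k.+1).
Proof.
move=> x0 H; pose f k x := sval (cid (H k x)).
pose s := nat_rect T x0 f; exists s => k; exact: (svalP (cid (H k (s k)))).
Qed.

Section Transfer.
Variable R : pzRingType.

Lemma detects_comp (Q : lmodType R -> Prop) (M : rmodType R) n k l
    (m : 'I_n -> M) (m' : 'I_k -> M) (C : 'M[R]_(k, n)) (D : 'M[R]_(l, k)) :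
  m = rcomb m' C -> detects Q m' D -> detects Q m (D *m C).
Proof.
by move=> -> detD A QA q; rewrite tens_rcomb -lcombA => /(detD A QA).
Qed.

(** If a tuple of stage [k] pairs to zero in [N] with [q], then [q] dies at a
    later stage, so it pairs to zero in [M] too, and [B k] kills it.  Thus each
    tuple of [N] is detected one stage further. *)
Lemma detects_thread_colimit (Q : lmodType R -> Prop) (M N : rmodType R)
    (n : nat -> nat) (B : forall k, 'M[R]_(n k.+1, n k))
    (m : forall k, 'I_(n k) -> M) (e : forall k, 'I_(n k) -> N) :
  thread B m -> (forall k, detects Q (m k) (B k)) -> colimit_thread B e ->
  flat_ML_for Q N.
Proof.
move=> mT detB eC; split; first exact: colimit_flat eC.
have [eT eE e0] := eC; apply: factor_mittag_leffler => p x.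
have [k [C xE]] := exhausts_tuple x eT eE.
exists (n k.+1), (e k.+1), (B k *m C); split.
  by rewrite xE [in LHS]eT rcombA.
apply: (detects_comp xE) => A QA q /e0[j [X [trX Xq]]].
by apply: detB => //; rewrite (thread_trans mT trX) tens_rcomb Xq tens0r.
Qed.

(** The module [N] to which the assumption is applied is the colimit of a
    sequence built inside [M], whose matrices detect [Q] while a chosen tuple
    from [Q'] is killed at each step for the first time. *)
Lemma flat_ML_transfer (Q Q' : lmodType R -> Prop) (M : rmodType R) :
  (forall N : rmodType R, countably_presented N -> flat_ML_for Q N ->
     mittag_leffler_for Q' N) ->
  flat_ML_for Q M -> flat_ML_for Q' M.
Proof.
move=> HN QM; have [flM _] := QM; split=> //.
apply: factor_mittag_leffler => n0 m0; apply: contrapT => Hbad.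
(* A state is a factorization [m0 = m P] of the tuple that violates the
   conclusion. *)
pose T := {s : {k & (('I_k -> M) * 'M[R]_(k, n0))%type} |
  m0 = rcomb (projT2 s).1 (projT2 s).2}.
pose step (_ : nat) (s s' : T) := exists B : 'M[R]_(_, _),
  [/\ (projT2 (sval s)).1 = rcomb (projT2 (sval s')).1 B,
      (projT2 (sval s')).2 = B *m (projT2 (sval s)).2,
      detects Q (projT2 (sval s)).1 B
    & exists A : lmodType R, Q' A /\ exists q : 'I_n0 -> A,
        [/\ tens m0 q = 0, lcomb (projT2 (sval s)).2 q <> 0
          & lcomb (projT2 (sval s')).2 q = 0]].
have [||s sP] := @dependent_choice (fun=> T) step.
- by exists (existT _ n0 (m0, 1%:M)); rewrite /= rcomb1.
- move=> i [[k [m P]] /= mP].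
  have [A [QA [q [mq0 Pq]]]] : exists A : lmodType R, Q' A /\
      exists q : 'I_n0 -> A, tens m0 q = 0 /\ lcomb P q <> 0.
    apply: contrapT => Hno; apply: Hbad; exists k, m, P; split=> // A QA q mq0.
    by apply: contrapT => Pq; apply: Hno; exists A; split=> //; exists q.
  (* Factor [m] first to kill [P q], then once more to detect [Q]. *)
  have := mq0; rewrite [in tens _ _]mP tens_rcomb => /(flat_tens_eq0 flM).
  move=> [k1 [m1 [C [mE CPq]]]].
  have [k2 [m2 [D [m1E detD]]]] := mittag_leffler_factor m1 QM.
  have m2P : m0 = rcomb m2 (D *m C *m P) by rewrite -!rcombA -m1E -mE.
  exists (exist _ (existT _ k2 (m2, D *m C *m P)) m2P).
  exists (D *m C); split=> //=.
  - by rewrite -rcombA -m1E.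
  - exact: detects_comp mE detD.
  - exists A; split=> //; exists q; split=> //.
    by rewrite -!lcombA CPq lcomb0.
pose n k := projT1 (sval (s k)).
pose m k : 'I_(n k) -> M := (projT2 (sval (s k))).1.
pose P k : 'M[R]_(n k, n0) := (projT2 (sval (s k))).2.
pose B k : 'M[R]_(n k.+1, n k) := sval (cid (sP k)).
have mT : thread B m by move=> k; case: (svalP (cid (sP k))).
have PS k : P k.+1 = B k *m P k by case: (svalP (cid (sP k))).
have detB k : detects Q (m k) (B k) by case: (svalP (cid (sP k))).
have [N [e [cpN eC]]] := colimit_exists B.
have [eT eE e0] := eC.
have QN := detects_thread_colimit mT detB eC.
have trP k j X : @trans _ _ B k j X -> P j = X *m P k.
  by elim=> {k j X} [k|k j X _ IH]; rewrite ?mul1mx// PS IH mulmxA.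
pose x := rcomb (e 0%N) (P 0%N).
have xE k : x = rcomb (e k) (P k).
  by elim: k => // k ->; rewrite PS -rcombA -eT.
have Q'N : flat_ML_for Q' N by split; [exact: QN.1 | exact: HN].
have [l [y [C [xy detC]]]] := mittag_leffler_factor x Q'N.
have [k [A yE]] := exhausts_tuple y eT eE.
have [j [X [trX XD]]] : exists j X, @trans _ _ B k j X /\
    lcomb X (mxrows (P k - A *m C)) = 0.
  by apply/e0/tens_mxrows; rewrite rcombB -xE -rcombA -yE -xy subrr.
(* From stage [j] on, the factorization given by [N] agrees with that of the
   sequence, so [P j] detects [Q'] on the image of [m0] in [N]. *)
have Pj : P j = X *m A *m C.
  apply/eqP; rewrite -subr_eq0 (trP _ _ _ trX) -mulmxA -mulmxBr; apply/eqP.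
  by apply: mxrows_eq0; rewrite mxrows_lcomb.
case: (svalP (cid (sP j))) => _ _ _ [A' [Q'A' [q [_ Pq Pq1]]]].
apply: Pq; rewrite -/(P j) Pj -lcombA (detC A' Q'A') ?lcomb0//.
by rewrite (xE j.+1) tens_rcomb Pq1 tens0r.
Qed.

End Transfer.

(** * Projective modules *)

Section Projective.
Variable R : pzRingType.

(** A splitting [h] of the canonical map from the free module on the set [M]
    yields a dual basis: [m_j] is the sum of the [x (h m_j)_x] over the finitely
    many [x] in the supports, and the matrix of these coordinates detects every
    module because each coordinate is a linear form, which can be applied to a
    relation in the tensor product. *)
Lemma projective_mittag_leffler (Q : lmodType R -> Prop) (M : rmodType R) :
  projective M -> mittag_leffler_for Q M.
Proof.
move=> prM.
pose p : {linear free_mod R^c M -> M} := free_lift (fun x : M => x).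
have p_surj z : exists u, p u = z by exists (free_gen R^c z); exact: free_lift_gen.
have [h hP] := prM _ _ p idfun p_surj.
apply: factor_mittag_leffler => n m.
pose S := (\bigcup_(j in [set: 'I_n]) [set x | h (m j) x <> 0])%classic.
have /finite_seqP[r0 Sr] : finite_set S.
  by apply: bigcup_finite => // j _; exact: free_mod_finite.
pose r := undup r0.
exists (size r), (tnth (in_tuple r)),
  (\matrix_(i, j) (h (m j) (tnth (in_tuple r) i) : R)); split.
  apply: funext => j; rewrite -[LHS]hP /p /=.
  have rS : S = [set` r]%classic.
    by rewrite Sr; apply/seteqP; split=> x /=; rewrite mem_undup.
  rewrite (@free_liftE _ _ _ _ _ [set` r]%classic); last 2 first.
  - by rewrite -rS; rewrite Sr; exact: finite_seq.
  - by move=> x hx; rewrite -rS; exists j.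
  rewrite -fsbig_seq ?undup_uniq// big_tnth /rcomb.
  by apply: eq_bigr => i _; rewrite mxE.
move=> A QA q mq0; apply: funext => i; set z := tnth (in_tuple r) i.
pose f (y : M) (a : A) : A := (h y z : R) *: a.
transitivity (\sum_j f (m j) (q j)).
  by apply: eq_bigr => j _; rewrite mxE.
apply: (@tens_eq0_mod R M A A (fun a => a = 0) f) mq0 => //.
- by move=> x y -> ->; rewrite subrr.
- by move=> y y' a; rewrite /f linearD -scalerDl subrr.
- by move=> y a a'; rewrite /f scalerDr subrr.
- by move=> y b a; rewrite /f linearZ scalerA subrr.
Qed.

(** The test module is the cokernel of [Y], a quotient of [R^n]: the images of
    the basis vectors are killed by [Y], hence by [B], which says that the rows
    of [B] are combinations of the rows of [Y]. *)
Lemma detects_all_factor (M : rmodType R) n k l (m : 'I_n -> M)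
    (m' : 'I_l -> M) (B : 'M[R]_(k, n)) (Y : 'M[R]_(l, n)) :
  detects (fun=> True) m B -> m = rcomb m' Y -> exists C, B = C *m Y.
Proof.
move=> detB mY.
pose U (v : 'rV[R]_n) := exists r : 'rV[R]_l, v = r *m Y.
have U0 : U 0 by exists 0; rewrite mul0mx.
have UP (a : R) u v : U u -> U v -> U (a *: u + v).
  by move=> [r ->] [r' ->]; exists (a *: r + r'); rewrite mulmxDl scalemxAl.
have [A [p [p0 _]]] := quotmod_exists U0 UP.
have pE k' (Z : 'M[R]_(k', n)) : lcomb Z (p \o mxrows 1%:M) = p \o mxrows Z.
  by rewrite -lcomb_linear -mxrowsE.
have /choice[c cP] i : exists r, row i B = r *m Y.
  apply/p0; suff /(congr1 (@^~ i)) : p \o mxrows B = 0 by [].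
  rewrite -pE; apply: detB => //; rewrite mY tens_rcomb pE.
  rewrite (_ : p \o _ = 0) ?tens0r//; apply: funext => h; apply/p0.
  by exists (row h 1%:M); rewrite /mxrows -row_mul mul1mx.
exists (\matrix_i c i); apply/row_matrixP => i.
by rewrite row_mul rowK.
Qed.

(** A module exhausted by a thread whose matrices detect all modules is the
    colimit of the sequence, and a lifting problem for it is solved stage by
    stage. *)
Section Lifting.
Variables (M : rmodType R) (n : nat -> nat) (B : forall k, 'M[R]_(n k.+1, n k)).
Variable (m : forall k, 'I_(n k) -> M).
Arguments m : clear implicits.
Hypotheses (mT : thread B m) (mE : exhausts m).
Hypothesis detB : forall k, detects (fun=> True) (m k) (B k).

Lemma thread_rel k p (c : 'M[R]_(n k, p)) :
  rcomb (m k) c = 0 -> B k *m c = 0.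
Proof.
by move=> /tens_mxrows /(detB I); rewrite -mxrows_lcomb => /mxrows_eq0.
Qed.

(** Let [u_k] lift [f m_{k+1}] along [g].  An arbitrary lift [v] of [f m_{k+2}]
    differs from it by [d = v B_{k+1} - u_k], whose entries lie in the kernel of
    [g].  With [B_k = C B_{k+1} B_k], replacing [v] by [v - d C] makes
    [u_{k+1} B_{k+1} B_k = u_k B_k].  So the tuples [u_k B_k] form a thread; the
    shift by one stage also makes them respect the relations between the [m_k]
    ([thread_rel]), which all die one stage later. *)
Lemma thread_lift (X Y : rmodType R) (g : {linear X -> Y}) (f : {linear M -> Y}) :
  (forall y, exists x, g x = y) ->
  exists a : forall k, 'I_(n k) -> X,
    [/\ thread B a, forall k, g \o a k = f \o m k
      & forall k p (c : 'M[R]_(n k, p)), B k *m c = 0 -> rcomb (a k) c = 0].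
Proof.
move=> g_surj.
have lift k : exists v : 'I_(n k) -> X, g \o v = f \o m k.
  have /choice[v vP] i := g_surj (f (m k i)).
  by exists v; apply: funext.
pose T k := {u : 'I_(n k.+1) -> X | g \o u = f \o m k.+1}.
pose step k (u : T k) (u' : T k.+1) :=
  rcomb (sval u') (B k.+1 *m B k) = rcomb (sval u) (B k).
have [||u uP] := @dependent_choice T step.
- by have /cid[v vP] := lift 1%N; exists v.
- move=> k [u uP]; have [v vP] := lift k.+2.
  have [C BC] : exists C, B k = C *m (B k.+1 *m B k).
    apply: (detects_all_factor (detB (k := k)) (m' := m k.+2)).
    by rewrite -rcombA -!mT.
  pose d := rcomb v (B k.+1) - u.
  have gd : g \o d = 0.
    apply: funext => i; have /(congr1 (@^~ i)) /= ui := uP.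
    rewrite /d /= linearB /= ui -[X in X - _]/((g \o rcomb v (B k.+1)) i).
    by rewrite rcomb_linear vP -rcomb_linear -mT /= subrr.
  have wP : g \o (v - rcomb d C) = f \o m k.+2.
    rewrite -vP; apply: funext => i; rewrite /= linearB /=.
    rewrite -[X in _ - X]/((g \o rcomb d C) i) rcomb_linear gd rcomb0l.
    by rewrite subr0.
  exists (exist _ (v - rcomb d C) wP); rewrite /step /=.
  by rewrite rcombBl rcombA -BC -rcombA -rcombBl /d opprB addrC subrK.
exists (fun k => rcomb (sval (u k)) (B k)); split.
- by move=> k; rewrite rcombA uP.
- by move=> k; rewrite rcomb_linear (svalP (u k)) -rcomb_linear -mT.
- by move=> k p c Bc; rewrite rcombA Bc rcomb0.
Qed.

Lemma thread_projective : projective M.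
Proof.
move=> X Y g f g_surj; have [a [aT ga a0]] := thread_lift f g_surj.
have wd k (c : 'cV[R]_(n k)) k' (c' : 'cV[R]_(n k')) :
    rcomb (m k) c = rcomb (m k') c' -> rcomb (a k) c = rcomb (a k') c'.
  have [X1 tr1] := trans_exists B (leq_maxl k k').
  have [X2 tr2] := trans_exists B (leq_maxr k k').
  rewrite (thread_trans mT tr1) (thread_trans mT tr2) => /eqP.
  rewrite (thread_trans aT tr1) (thread_trans aT tr2) => /eqP.
  rewrite !rcombA => E; apply: subr0_eq; rewrite -rcombB; apply: a0.
  by apply: thread_rel; rewrite rcombB E subrr.
have ext1 (Z : Type) (u v : 'I_1 -> Z) : u ord0 = v ord0 -> u = v.
  by move=> uv; apply: funext => i; rewrite ord1.
have /choice[c cP] z : exists c : {k & 'cV[R]_(n k)},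
    z = rcomb (m (projT1 c)) (projT2 c) ord0.
  by have [k [c ->]] := mE z; exists (existT _ k c).
pose h z := rcomb (a (projT1 (c z))) (projT2 (c z)) ord0.
have hE k (d : 'cV[R]_(n k)) : h (rcomb (m k) d ord0) = rcomb (a k) d ord0.
  by rewrite /h (wd _ _ k d)//; apply: ext1; rewrite -cP.
have hL : linear h.
  move=> r z w; have [k [d ->]] := mE z; have [k' [d' ->]] := mE w.
  have [X1 tr1] := trans_exists B (leq_maxl k k').
  have [X2 tr2] := trans_exists B (leq_maxr k k').
  have addE (V : rmodType R) (b : forall k, 'I_(n k) -> V) : thread B b ->
      r *: rcomb (b k) d ord0 + rcomb (b k') d' ord0 =
      rcomb (b (maxn k k')) (X1 *m d *m (r : R)%:M + X2 *m d') ord0.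
    move=> bT; rewrite (thread_trans bT tr1) (thread_trans bT tr2).
    by rewrite rcombD -!rcombA -rcomb_scalar.
  by rewrite addE// hE !hE addE.
have [h' h'E] := linear_exists hL; exists h' => z.
rewrite h'E; have [k [d ->]] := mE z; rewrite hE.
by rewrite -[LHS]/((g \o rcomb _ _) _) rcomb_linear ga -rcomb_linear.
Qed.

End Lifting.

Lemma countably_presented_projective (M : rmodType R) :
  countably_presented M -> flat_ML M -> projective M.
Proof.
move=> [_ [L [_ [g [_ g_surj]]]]] MLM.
(* An enumeration of generators, padded by zero; generator number [k] is added
   to the tuple at step [k]. *)
pose x k : M := if @unpickle L k is Some l then g (free_gen R^c l) else 0.
pose T := {k & 'I_k -> M}.
pose step k (s s' : T) := exists B : 'M[R]_(_, _),
  [/\ projT2 s = rcomb (projT2 s') B, detects (fun=> True) (projT2 s) B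
    & exists c : 'cV[R]_(_), x k = rcomb (projT2 s') c ord0].
have [||s sP] := @dependent_choice (fun=> T) step.
- by exists 0%N => _; exact: 0.
- move=> k [n m]; have [n' [m' [B [mB detB]]]] := mittag_leffler_factor m MLM.
  exists (existT _ (n' + 1)%N (tcat m' (fun=> x k))), (col_mx B 0); split=> /=.
  + by rewrite rcomb_tcat rcomb0 addr0.
  + move=> A QA q mq0; rewrite lcomb_col (detB A QA q mq0) lcomb0l.
    by apply: funext => i; rewrite /tcat; case: fintype.split.
  + by exists (col_mx 0 1%:M); rewrite rcomb_tcat rcomb0 add0r rcomb1.
pose n k := projT1 (s k).
pose m k : 'I_(n k) -> M := projT2 (s k).
pose B k : 'M[R]_(n k.+1, n k) := sval (cid (sP k)).
have mT : thread B m by move=> k; case: (svalP (cid (sP k))).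
have detB k : detects (fun=> True) (m k) (B k).
  by case: (svalP (cid (sP k))).
apply: (thread_projective mT _ detB).
apply: (exhausts_gen mT g_surj) => l; exists (pickle l).+1.
by case: (svalP (cid (sP (pickle l)))) => _ _; rewrite /x pickleK.
Qed.

End Projective.

Lemma mittag_leffler_empty (R : pzRingType) (M : rmodType R) :
  mittag_leffler_for (fun=> False) M.
Proof.
by apply: factor_mittag_leffler => n m; exists n, m, 1%:M; split=> //; rewrite rcomb1.
Qed.

Theorem theorem2p5 (R : pzRingType) :
  (forall Q Q' : lmodType R -> Prop, Q R^o -> Q' R^o ->
     (same_class (flat_ML_for Q) (flat_ML_for Q') <->
      (forall M : rmodType R, countably_presented M ->
         (flat_ML_for Q M <-> flat_ML_for Q' M))))
  /\
  (forall Q : lmodType R -> Prop,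
     (same_class (flat_ML_for Q) (@flat R) <->
      (forall M : rmodType R, countably_presented M -> flat M ->
         mittag_leffler_for Q M)))
  /\
  (forall Q : lmodType R -> Prop, Q R^o ->
     (same_class (flat_ML_for Q) (@flat_ML R) <->
      (forall M : rmodType R, countably_presented M -> flat_ML_for Q M ->
         projective M))).
Proof.
split; [move=> Q Q' _ _ | split=> [Q | Q _]].
- split=> [QQ' M _|QQ' M]; first exact: QQ'.
  by split; apply: flat_ML_transfer => N cpN /(QQ' N cpN)[].
- split=> [QF M _ flM|H M]; first by case: ((QF M).2 flM).
  split=> [[]//|flM]; apply: (@flat_ML_transfer R (fun=> False)).
    by move=> N cpN [flN _]; exact: H.
  by split=> //; exact: mittag_leffler_empty.
- split=> [QF M cpM QM|H M].
    by apply: countably_presented_projective => //; apply/QF.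
  split=> [|[flM MLM]].
    by apply: flat_ML_transfer => N cpN QN; exact/projective_mittag_leffler/H.
  by split=> // I N _; exact: MLM.
Qed.
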